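(* Let $n$ be a positive integer and let $W_\alpha$ be an $n$-quasinormal unilateral weighted shift. Then the weight sequence $\alpha$ is periodic with period at most $n$.
   Context: Given a bounded sequence $\alpha \equiv \{\alpha_j\}_{j\ge 0}$ of positive real numbers, the unilateral weighted shift $W_\alpha$ is the bounded linear operator on $\ell^2$ (with standard orthonormal basis $\{e_j\}_{j=0}^\infty$) determined by $W_\alpha e_j := \alpha_j e_{j+1}$ for $j \ge 0$. A bounded Hilbert space operator $A$ is quasinormal if $A$ commutes with $A^*A$. A bounded operator $T$ is $n$-quasinormal if $T^n$ is quasinormal, i.e. $T^n$ commutes with $T^{*n}T^n$. The sequence $\alpha$ is periodic with period at most $n$ if there is an integer $p$ with $1\le p\le n$ and $\alpha_{j+p}=\alpha_j$ for all $j\ge 0$. *)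

(* Defs.v *)
From HB Require Import structures.
From mathcomp Require Import all_boot all_order all_algebra.
From mathcomp Require Import all_classical all_reals all_analysis.
From mathcomp Require Import complex ring.

Set Implicit Arguments.
Unset Strict Implicit.
Unset Printing Implicit Defensive.
Import Order.TTheory GRing.Theory Num.Theory.
Import numFieldNormedType.Exports.
Local Open Scope ring_scope.
Local Open Scope classical_set_scope.

(* [normc : R[i] -> R] is the modulus with values in R; [`|z|] for z : R[i]
   would take its values in R[i]. *)
Notation normc := ComplexField.Normc.normc.

Section SquareSummable.
Variable R : realType.
Implicit Types u v : nat -> R[i].

Definition square_summable u : Prop :=
  cvgn (series (fun j => normc (u j) ^+ 2)).

Definition l2_pred : {pred nat -> R[i]} := fun u => `[< square_summable u >].

Lemma normc_ge0 (z : R[i]) : 0 <= normc z.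
Proof. by case: z => a b; exact: sqrtr_ge0. Qed.

Lemma l2_submod_closed : submod_closed l2_pred.
Proof.
split=> [|a u v /asboolP uS /asboolP vS]; apply/asboolP.
  rewrite /square_summable (_ : series _ = cst 0); first exact: is_cvg_cst.
  apply/funext => n; rewrite [LHS]big1 // => j _.
  by rewrite [normc _]ComplexField.Normc.normc0 expr0n.
pose w j := (2 * normc a ^+ 2) * normc (u j) ^+ 2 + 2 * normc (v j) ^+ 2.
apply: (@series_le_cvg _ _ w) => [j|j|j|].
- by apply: exprn_ge0; exact: normc_ge0.
- by rewrite addr_ge0 // !mulr_ge0 // ?exprn_ge0 // normc_ge0.
- rewrite /w -mulrA -exprMn -ComplexField.Normc.normcM.
  have := le_normcD (a * u j) (v j).
  set s := normc (a * u j); set t := normc (v j) => st.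
  apply: (@le_trans _ _ ((s + t) ^+ 2)).
    by rewrite lerXn2r // nnegrE ?addr_ge0 ?normc_ge0.
  by rewrite -subr_ge0 (_ : _ - _ = (s - t) ^+ 2) ?sqr_ge0 //; ring.
- have -> : series w = (2 * normc a ^+ 2) *: series (fun j => normc (u j) ^+ 2)
      + 2 *: series (fun j => normc (v j) ^+ 2).
    apply/funext => n; rewrite !fctE !seriesEnat /= !scaler_sumr -big_split.
    exact: eq_bigr.
  by apply: is_cvgD; apply: is_cvgZr.
Qed.

HB.instance Definition _ :=
  GRing.isSubmodClosed.Build R[i] (nat -> R[i]) l2_pred l2_submod_closed.

End SquareSummable.

Record l2 (R : realType) : Type :=
  L2 { l2_val :> nat -> R[i]; l2_valP : l2_val \in @l2_pred R }.

HB.instance Definition _ (R : realType) := [isSub for @l2_val R].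
HB.instance Definition _ (R : realType) := [Choice of l2 R by <:].
HB.instance Definition _ (R : realType) :=
  [SubChoice_isSubLmodule of l2 R by <:].

Section Operators.
Variable R : realType.
Implicit Types (x y : l2 R) (A B T W : l2 R -> l2 R) (alpha : nat -> R).

Definition l2_inner x y : R[i] :=
  limn (series (fun j => x j * conjc (y j)) : nat -> R[i]^o).

Definition l2_norm x : R :=
  Num.sqrt (limn (series (fun j => normc (x j) ^+ 2))).

Lemma l2_basis_subproof (k : nat) :
  (fun j => (j == k)%:R : R[i]) \in @l2_pred R.
Proof.
apply/asboolP; apply/cvg_ex; exists (1 : R); apply: cvg_near_cst.
exists k.+1 => // n /= kn; rewrite seriesEnat /= (bigD1_seq k) ?iota_uniq //=.
  rewrite eqxx ComplexField.Normc.normc1 expr1n big1 ?addr0 // => j /negPf ->.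
  by rewrite ComplexField.Normc.normc0 expr0n.
by rewrite mem_index_iota.
Qed.

Definition l2_basis (k : nat) : l2 R := L2 (l2_basis_subproof k).

Definition bounded_operator T : Prop :=
  linear T /\ exists M : R, forall x, l2_norm (T x) <= M * l2_norm x.

(* B = A^*; such a B is unique, and it exists when A is a bounded operator. *)
Definition is_adjoint A B : Prop :=
  forall x y, l2_inner (A x) y = l2_inner x (B y).

Definition quasinormal A : Prop :=
  exists2 B, is_adjoint A B & A \o (B \o A) = (B \o A) \o A.

Definition n_quasinormal (n : nat) T : Prop := quasinormal (iter n T).

Definition is_weighted_shift alpha W : Prop :=
  bounded_operator W /\
  forall j, W (l2_basis j) = (alpha j)%:C%C *: l2_basis j.+1.

End Operators.

Definition periodic_at_most (T : Type) (n : nat) (alpha : nat -> T) : Prop :=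
  exists p : nat, (1 <= p <= n)%N /\ forall j, alpha (j + p)%N = alpha j.

(* Main.v *)
Require Import Defs.
From mathcomp Require Import all_boot all_order all_algebra.
From mathcomp Require Import all_classical all_reals all_analysis.
From mathcomp Require Import complex ring lra.
Import Order.TTheory GRing.Theory Num.Theory.
Local Open Scope ring_scope.

(** The power [T = W^n] is again a shift: [T e_j = beta_j e_(j+n)] with
    [beta_j = alpha_j * ... * alpha_(j+n-1)].  Its adjoint [B] is therefore the
    backward shift [(B x)_j = beta_j x_(j+n)].  Applied to [e_j], the relation
    [T (B T) = (B T) T] reads [beta_j^3 = beta_j beta_(j+n)^2], so that
    [beta_(j+n) = beta_j] ([quasinormal_shift_power_weight]).

    What remains is a fact on bounded positive sequences
    ([periodic_of_periodic_block_prod]).  The ratio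
    [r_j = alpha_(j+n) / alpha_j = beta_(j+1) / beta_j] is [n]-periodic because
    [beta] is, whence [alpha_(j+kn) = r_j^k alpha_j], and boundedness forces
    [r_j <= 1].  Thus [beta] is nonincreasing; being periodic too, it is
    constant, so every [r_j] equals [1] and [alpha] has period [n]. *)

Definition block_prod {R : realType} (n : nat) (a : nat -> R) (j : nat) : R :=
  \prod_(i < n) a (j + i)%N.

Lemma block_prod_gt0 (R : realType) n (a : nat -> R) j :
  (forall j, 0 < a j) -> 0 < block_prod n a j.
Proof. by move=> a_gt0; apply: prodr_gt0. Qed.

Lemma block_prodS (R : realType) n (a : nat -> R) j :
  block_prod n.+1 a j = block_prod n a j * a (j + n)%N.
Proof. by rewrite /block_prod big_ord_recr. Qed.

(** Both sides are the product of the [n + 1] terms starting at [j]. *)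
Lemma block_prod_slide (R : realType) n (a : nat -> R) j :
  a j * block_prod n a j.+1 = block_prod n a j * a (j + n)%N.
Proof.
rewrite -block_prodS /block_prod big_ord_recl addn0; congr (_ * _).
by apply: eq_bigr => i _; rewrite addSnnS.
Qed.

Lemma le1_of_bounded_expr (R : realType) (r c M : R) :
  0 < c -> (forall k, r ^+ k * c <= M) -> r <= 1.
Proof.
move=> c_gt0 rM; rewrite leNgt; apply/negP => r_gt1.
(* Bernoulli's inequality makes the powers of [r] grow at least linearly. *)
have bern k : 1 + k%:R * (r - 1) <= r ^+ k.
  elim: k => [|k IH]; first by rewrite mul0r addr0 expr0.
  rewrite exprS; apply: le_trans (ler_wpM2l _ IH); last by lra.
  rewrite -subr_ge0 -natr1 (_ : _ - _ = k%:R * (r - 1) ^+ 2); last by ring.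
  by rewrite mulr_ge0 ?sqr_ge0.
have d_gt0 : 0 < (r - 1) * c by rewrite mulr_gt0 ?subr_gt0.
have [k Mk] : exists k : nat, M / ((r - 1) * c) < k%:R.
  by exists (Num.truncn (M / ((r - 1) * c))).+1; exact: truncnS_gt.
have := rM k; rewrite leNgt => /negP; apply.
move: Mk; rewrite ltr_pdivrMr // => /lt_le_trans; apply.
rewrite mulrA ler_wpM2r ?(ltW c_gt0) //.
by apply: le_trans (bern k); rewrite lerDr.
Qed.

Lemma periodic_of_periodic_block_prod (R : realType) n (a : nat -> R) (M : R) :
  (0 < n)%N -> (forall j, 0 < a j) -> (forall j, a j <= M) ->
  (forall j, block_prod n a (j + n) = block_prod n a j) ->
  forall j, a (j + n)%N = a j.
Proof.
move=> n_gt0 a_gt0 aM; set b := block_prod n a => b_per.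
have b_gt0 j : 0 < b j by exact: block_prod_gt0.
have a_neq0 j : a j != 0 by rewrite gt_eqF.
have b_neq0 j : b j != 0 by rewrite gt_eqF.
pose r j := b j.+1 / b j.
have a_shift j : a (j + n)%N = r j * a j.
  by apply: (mulfI (b_neq0 j)); rewrite -block_prod_slide -/b /r; field.
have r_per j k : r (j + k * n)%N = r j.
  elim: k => [|k IH]; first by rewrite addn0.
  by rewrite mulSn addnCA addnC /r -addSn !b_per.
have a_iter j k : a (j + k * n)%N = r j ^+ k * a j.
  elim: k => [|k IH]; first by rewrite addn0 expr0 mul1r.
  by rewrite mulSn addnCA addnC a_shift IH r_per exprS mulrA.
have b_step j : b j.+1 <= b j.
  suff: r j <= 1 by rewrite /r ler_pdivrMr // mul1r.
  by apply: (@le1_of_bounded_expr _ _ (a j) M) => // k; rewrite -a_iter.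
have b_noninc j k : b (j + k)%N <= b j.
  elim: k => [|k IH]; first by rewrite addn0.
  by rewrite addnS; exact: le_trans (b_step _) IH.
(* Going once around the period: [b j = b (j + n) <= b j.+1 <= b j]. *)
have b_const j : b j.+1 = b j.
  apply/eqP; rewrite eq_le b_step /= -(b_per j).
  by rewrite -(prednK n_gt0) addnS -addSn b_noninc.
by move=> j; rewrite a_shift /r b_const divff ?mul1r.
Qed.

(** The partial sums of the series are constant past the index [k], so the
    limit is attained. *)
Lemma l2_innerZ_basis (R : realType) (c : R[i]) k (x : l2 R) :
  l2_inner (c *: l2_basis R k) x = c * conjc (x k).
Proof.
rewrite /l2_inner; apply: (@cvg_lim R[i]^o) => //; apply: cvg_near_cst.
exists k.+1 => // m /= km; rewrite seriesEnat /= (bigD1_seq k) ?iota_uniq //=.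
  rewrite big1 ?addr0 => [|j /negPf jk].
    by rewrite [X in X * _](_ : _ = c * (k == k)%:R) // eqxx mulr1.
  by rewrite [X in X * _](_ : _ = c * (j == k)%:R) // jk mulr0 mul0r.
by rewrite mem_index_iota.
Qed.

Lemma l2_inner_basisl (R : realType) k (x : l2 R) :
  l2_inner (l2_basis R k) x = conjc (x k).
Proof. by rewrite -[l2_basis R k]scale1r l2_innerZ_basis mul1r. Qed.

(** The scalar [c] lets the formula be applied to its own output, as in
    [T (T e_j)] or [T (B (T e_j))] with [T = W^n]. *)
Lemma weighted_shift_iterZ (R : realType) (alpha : nat -> R) W n j (c : R[i]) :
  is_weighted_shift alpha W ->
  iter n W (c *: l2_basis R j) =
    (c * (block_prod n alpha j)%:C%C) *: l2_basis R (j + n).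
Proof.
move=> [[linW _] We].
have W0 : W 0 = 0.
  by have := linW (-1) 0 0; rewrite scaler0 addr0 scaleN1r addNr.
have WZ a u : W (a *: u) = a *: W u.
  by have := linW a u 0; rewrite W0 !addr0.
elim: n => [|n IH] /=.
  by rewrite /block_prod big_ord0 rmorph1 mulr1 addn0.
by rewrite IH WZ We scalerA block_prodS rmorphM mulrA addnS.
Qed.

(** Conjugating, [conj (B x)_j = <e_j, B x> = <W^n e_j, x>], and [W^n e_j] is
    a multiple of [e_(j+n)]. *)
Lemma adjoint_shift_power (R : realType) (alpha : nat -> R) W n B :
  is_weighted_shift alpha W -> is_adjoint (iter n W) B ->
  forall (x : l2 R) j, B x j = (block_prod n alpha j)%:C%C * x (j + n)%N.
Proof.
move=> Wsh adjB x j; apply: (can_inj (@conjcK R)).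
rewrite -l2_inner_basisl -adjB -[l2_basis R j]scale1r.
rewrite (weighted_shift_iterZ _ alpha)// mul1r l2_innerZ_basis rmorphM.
by congr (_ * _); rewrite /= oppr0.
Qed.

(** With [T = W^n] and [B] its adjoint, the coordinates of index [j + n] of
    [T B T e_j] and [B T T e_j] are compared. *)
Lemma quasinormal_shift_power_weight (R : realType) (alpha : nat -> R) W n :
  (forall j, 0 < alpha j) -> is_weighted_shift alpha W ->
  n_quasinormal n W ->
  forall j, block_prod n alpha (j + n) = block_prod n alpha j.
Proof.
move=> alpha_gt0 Wsh [B adjB comm] j.
set b := block_prod n alpha.
have b_gt0 i : 0 < b i by exact: block_prod_gt0.
have Te i c := weighted_shift_iterZ R alpha W n i c Wsh.
have BE := adjoint_shift_power R alpha W n B Wsh adjB.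
have coordZ (c : R[i]) i k : (c *: l2_basis R i) k = c * (k == i)%:R by [].
have BTe : B (iter n W (l2_basis R j)) = ((b j)%:C%C * (b j)%:C%C) *: l2_basis R j.
  apply: val_inj; apply/funext => i; rewrite [LHS]BE -[l2_basis R j]scale1r Te.
  rewrite scale1r mul1r coordZ eqn_add2r [RHS]coordZ mulrA.
  by case: eqVneq => [->//|_]; rewrite !mulr0.
have /(congr1 (fun x : l2 R => x (j + n)%N)) :
    iter n W (B (iter n W (l2_basis R j))) =
    B (iter n W (iter n W (l2_basis R j))).
  exact: (congr1 (fun f => f (l2_basis R j)) comm).
rewrite BTe Te BE -[l2_basis R j]scale1r !Te !coordZ !eqxx !mulr1 mul1r.
rewrite -!rmorphM => /complexI; rewrite -/b mulrCA -mulrA.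
move=> /(mulfI (lt0r_neq0 (b_gt0 j)))/esym/eqP.
by rewrite -!expr2 eqrXn2 ?ltW // => /eqP.
Qed.

Theorem theorem4p5 (R : realType) (n : nat) (alpha : nat -> R)
    (W : l2 R -> l2 R) :
  (0 < n)%N ->
  (forall j, 0 < alpha j) ->
  (exists M : R, forall j, alpha j <= M) ->
  is_weighted_shift alpha W ->
  n_quasinormal n W ->
  periodic_at_most n alpha.
Proof.
move=> n_gt0 alpha_gt0 [M alphaM] Wsh nq.
exists n; split; first by rewrite n_gt0 leqnn.
apply: (periodic_of_periodic_block_prod _ _ _ M) => //.
exact: quasinormal_shift_power_weight Wsh nq.
Qed.
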